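(* Let $\mathcal{A}=\{\alpha_1,\dots,\alpha_n\}$ be a Euclidean $\vee$-system in $\mathbb{R}^d$. Then the associated hyperplane arrangement $\Delta_{\mathcal{A}}=\{\alpha_1^\perp,\dots,\alpha_n^\perp\}$ is simplicial.
   Context: $\mathbb{R}^d$ carries its standard Euclidean inner product $(\cdot,\cdot)$. Euclidean $\vee$-system in $\mathbb{R}^d$: a finite set $\mathcal{A}=\{\alpha_1,\dots,\alpha_n\}\subset\mathbb{R}^d\setminus\{0\}$ of pairwise non-proportional vectors such that: (V1) $\sum_{i=1}^n (x,\alpha_i)^2=|x|^2$ for all $x\in\mathbb{R}^d$; (V2) for every linear $2$-plane $\Pi\subset\mathbb{R}^d$ with $|\mathcal{A}\cap\Pi|\ge 3$ there is $\nu(\Pi)\in\mathbb{R}$ with $\sum_{i:\alpha_i\in\Pi}(x,\alpha_i)^2=\nu(\Pi)|x|^2$ for all $x\in\Pi$; (V3) for every linear $2$-plane $\Pi$ with $\mathcal{A}\cap\Pi=\{\alpha_i,\alpha_j\}$, $i\ne j$, one has $(\alpha_i,\alpha_j)=0$. A chamber of an arrangement $\Delta$ of linear hyperplanes in $\mathbb{R}^d$ is a connected component of $\mathbb{R}^d\setminus\bigcup_{H\in\Delta}H$. The arrangement is simplicial if the closure of every chamber is a simplicial cone, i.e. a polyhedral cone generated by $d$ linearly independent vectors. *)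

(* Defs.v *)
From HB Require Import structures.
From mathcomp Require Import all_boot all_order all_algebra.
From mathcomp Require Import all_classical all_reals topology normedtype.
Set Implicit Arguments.
Unset Strict Implicit.
Unset Printing Implicit Defensive.
Import Order.TTheory GRing.Theory Num.Theory.
Import numFieldNormedType.Exports.
Local Open Scope classical_set_scope.
Local Open Scope ring_scope.

(* The library norm on row vectors is the sup norm, so |x|^2 is written
   [inner x x] below; the topology on ['rV[R]_d] is the usual one. *)
Definition inner (R : realType) (d : nat) (x y : 'rV[R]_d) : R :=
  \sum_(k < d) x 0 k * y 0 k.

Record euclidean_vee_system (R : realType) (d n : nat)
    (alpha : 'I_n -> 'rV[R]_d) : Prop := EuclideanVeeSystem {
  vee_neq0 : forall i, alpha i != 0;
  vee_nonproportional :
    forall i j : 'I_n, i != j -> forall c : R, alpha i <> c *: alpha j;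
  vee_V1 : forall x, \sum_i inner x (alpha i) ^+ 2 = inner x x;
  vee_V2 : forall P : {vspace 'rV[R]_d}, \dim P = 2%N ->
    (3 <= #|[pred i | alpha i \in P]|)%N ->
    exists nu : R, forall x, x \in P ->
      \sum_(i | alpha i \in P) inner x (alpha i) ^+ 2 = nu * inner x x;
  vee_V3 : forall P : {vspace 'rV[R]_d}, \dim P = 2%N ->
    forall i j : 'I_n, i != j -> [pred k | alpha k \in P] =i pred2 i j ->
    inner (alpha i) (alpha j) = 0
}.

Definition orthogonal_hyperplane (R : realType) (d : nat) (a : 'rV[R]_d) :
    set 'rV[R]_d :=
  [set x | inner x a = 0].

Definition arrangement_of (R : realType) (d n : nat)
    (alpha : 'I_n -> 'rV[R]_d) : set (set 'rV[R]_d) :=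
  range (fun i => orthogonal_hyperplane (alpha i)).

Definition arrangement_complement (R : realType) (d : nat)
    (Delta : set (set 'rV[R]_d)) : set 'rV[R]_d :=
  ~` \bigcup_(H in Delta) H.

Definition chamber (R : realType) (d : nat) (Delta : set (set 'rV[R]_d))
    (C : set 'rV[R]_d) : Prop :=
  exists2 x, arrangement_complement Delta x &
    C = connected_component (arrangement_complement Delta) x.

Definition simplicial_cone (R : realType) (d : nat) (K : set 'rV[R]_d) : Prop :=
  exists2 v : d.-tuple 'rV[R]_d, free v &
    K = [set x | exists2 c : 'I_d -> R, (forall i, 0 <= c i) &
                   x = \sum_(i < d) c i *: tnth v i].

Definition simplicial_arrangement (R : realType) (d : nat)
    (Delta : set (set 'rV[R]_d)) : Prop :=
  forall C, chamber Delta C -> simplicial_cone (closure C).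

(* Main.v *)
Require Import Defs.
From mathcomp Require Import all_boot all_order all_algebra.
From mathcomp Require Import all_classical all_reals topology normedtype.
From mathcomp Require Import ring lra.
Set Implicit Arguments.
Unset Strict Implicit.
Unset Printing Implicit Defensive.
Import Order.TTheory GRing.Theory Num.Theory.
Import numFieldNormedType.Exports.
Local Open Scope classical_set_scope.
Local Open Scope ring_scope.

(** Fix a chamber and a point [x0] in it, and orient every covector so that
    [beta k = +- alpha k] is positive at [x0].  The chamber is then the open
    cone where all [beta k] are positive ([chamberE]) and its closure is the
    closed cone where they are nonnegative ([closure_open_cone]).

    Take a minimal set [A] of the [beta k] generating the same convex cone as
    all of them ([irredundant_generators]); these are the normals of the walls.
    As for the simple roots of a Coxeter group, any two distinct walls satisfy
    [(beta i, beta j) <= 0] ([vee_walls_obtuse]).  In the plane of [beta i] and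
    [beta j], minimality of [A] forces every [beta k] of this plane to lie in
    the angle between the two ([cone_irredundant_coef_ge0]).  If the plane
    contains no third covector, (V3) says that the two are orthogonal.
    Otherwise (V2) says that the form [\sum_k (x, beta k)^2] over the plane is
    a multiple of the Euclidean one, so its polarization vanishes on
    orthogonal pairs.  If the angle were acute, take [x] along [beta i] and [y]
    orthogonal to it on the side of [beta j]: all the products
    [(x, beta k) (y, beta k)] would be nonnegative and the one for [beta j]
    positive, a contradiction.  (With complex coordinates in the plane, (V2)
    reads [\sum_k (beta k)^2 = 0], which is impossible for vectors in an acute
    angle, as their squares lie in an open half-plane.)

    Vectors that are pairwise at obtuse or right angles and all lie in an open
    half-space are linearly independent ([obtuse_free]), and by (V1) the
    [beta k], hence the walls, span the whole space.  So the wall normals form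
    a basis, and the closed chamber is generated by the dual basis
    ([simplicial_cone_of_basis]). *)

(** * The inner product *)

Section InnerProduct.
Variables (R : realType) (d : nat).
Implicit Types (x y z : 'rV[R]_d) (a : R).

Lemma innerC x y : inner x y = inner y x.
Proof. by apply: eq_bigr => k _; rewrite mulrC. Qed.

Lemma innerDl x y z : inner (x + y) z = inner x z + inner y z.
Proof. by rewrite -big_split; apply: eq_bigr => k _; rewrite mxE mulrDl. Qed.

Lemma innerZl a x y : inner (a *: x) y = a * inner x y.
Proof. by rewrite /inner big_distrr; apply: eq_bigr => k _; rewrite mxE -mulrA. Qed.

Lemma innerDr x y z : inner z (x + y) = inner z x + inner z y.
Proof. by rewrite innerC innerDl !(innerC z). Qed.

Lemma innerZr a x y : inner y (a *: x) = a * inner y x.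
Proof. by rewrite innerC innerZl innerC. Qed.

Lemma inner0l x : inner 0 x = 0.
Proof. by apply: big1 => k _; rewrite mxE mul0r. Qed.

Lemma inner_suml (I : finType) (P : pred I) (F : I -> 'rV[R]_d) x :
  inner (\sum_(i | P i) F i) x = \sum_(i | P i) inner (F i) x.
Proof.
by elim/big_rec2: _ => [|i u v _ <-]; [exact: inner0l | rewrite innerDl].
Qed.

Lemma inner_sumr (I : finType) (P : pred I) (F : I -> 'rV[R]_d) x :
  inner x (\sum_(i | P i) F i) = \sum_(i | P i) inner x (F i).
Proof. by rewrite innerC inner_suml; apply: eq_bigr => i _; rewrite innerC. Qed.

Lemma inner_ge0 x : 0 <= inner x x.
Proof. by apply: sumr_ge0 => k _; rewrite -expr2 sqr_ge0. Qed.

Lemma inner_eq0 x : inner x x = 0 -> x = 0.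
Proof.
move=> x0; apply/rowP => k; rewrite mxE; apply/eqP; rewrite -sqrf_eq0 expr2.
by apply/eqP; apply: (psumr_eq0P _ x0) => // i _; rewrite -expr2 sqr_ge0.
Qed.

Lemma inner_gt0 x : x != 0 -> 0 < inner x x.
Proof.
move=> x0; rewrite lt_def inner_ge0 andbT.
by apply: contra x0 => /eqP/inner_eq0 ->.
Qed.

Lemma inner_continuous y : continuous (fun x => inner x y).
Proof.
rewrite /inner; apply: continuous_big => [|k _ x]; first exact: add_continuous.
apply: cvgMr_tmp; first exact: (@nbhs_filter _ x).
exact: (@coord_continuous R 1 d 0 k x).
Qed.

End InnerProduct.

(** * Obtuse families and simplicial cones *)

Section ObtuseBases.
Variables (R : realType) (m d : nat) (b : 'I_m -> 'rV[R]_d) (x0 : 'rV[R]_d).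
Hypothesis b_pos : forall i, 0 < inner x0 (b i).
Hypothesis b_obtuse : forall i j, i != j -> inner (b i) (b j) <= 0.

(** Move the terms with nonpositive coefficients to the other side: the two
    sides write one vector [v] as nonnegative combinations of disjoint
    subfamilies, so expanding [(v, v)] gives only products of distinct vectors
    and shows [v = 0].
    Pairing [v] with [x0] then rules out any positive coefficient. *)
Lemma obtuse_relation_le0 (c : 'I_m -> R) :
  \sum_i c i *: b i = 0 -> forall i, c i <= 0.
Proof.
move=> c0.
pose v := \sum_(i | 0 < c i) c i *: b i.
have vE : v = \sum_(i | ~~ (0 < c i)) (- c i) *: b i.
  apply/eqP; rewrite -subr_eq0 -sumrN /v.
  under [X in _ + X]eq_bigr do rewrite scaleNr opprK.
  by move: c0; rewrite (bigID (fun i => 0 < c i))/= => ->.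
have v0 : v = 0.
  apply: inner_eq0; apply/eqP; rewrite eq_le inner_ge0 andbT.
  rewrite {1}vE inner_suml; apply: sumr_le0 => i ci.
  rewrite inner_sumr; apply: sumr_le0 => j cj.
  rewrite innerZl innerZr.
  apply: mulr_ge0_le0; first by rewrite oppr_ge0 leNgt.
  apply: mulr_ge0_le0; first exact: ltW.
  by apply: b_obtuse; apply: contraNneq ci => ->.
move=> i; rewrite leNgt; apply/negP => ci.
have : inner x0 v = 0 by rewrite v0 innerC inner0l.
rewrite inner_sumr => /psumr_eq0P s0.
have := s0 _ i ci; rewrite innerZr => ic0.
suff : 0 < c i * inner x0 (b i) by rewrite ic0 ?ltxx// => j cj;
  rewrite innerZr mulr_ge0 ?ltW.
by rewrite mulr_gt0.
Qed.

Lemma obtuse_free (c : 'I_m -> R) :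
  \sum_i c i *: b i = 0 -> forall i, c i = 0.
Proof.
move=> c0 i; apply/eqP; rewrite eq_le obtuse_relation_le0//=.
rewrite -oppr_le0; apply: (@obtuse_relation_le0 (fun i => - c i)).
by under eq_bigr do rewrite scaleNr; rewrite sumrN c0 oppr0.
Qed.

End ObtuseBases.

(** The generators of the cone are the vectors of the basis dual to [b].
    Independence and totality are the two rank conditions that make the matrix
    of [b] square and invertible; its inverse transpose is the dual basis. *)
Lemma simplicial_cone_of_basis (R : realType) (m d : nat)
    (b : 'I_m -> 'rV[R]_d) :
  (forall c : 'I_m -> R, \sum_i c i *: b i = 0 -> forall i, c i = 0) ->
  (forall x, (forall i, inner x (b i) = 0) -> x = 0) ->
  simplicial_cone [set x | forall i, 0 <= inner x (b i)].
Proof.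
move=> b_indep b_total.
pose B := \matrix_(i < m) b i.
have Brank : \rank B = m.
  apply/eqP; rewrite -/(row_free B) -kermx_eq0; apply/eqP/row_matrixP => i.
  rewrite row0; set u := row i _.
  have uB : u *m B = 0 by apply/sub_kermxP; exact: row_sub.
  apply/rowP => j; rewrite [RHS]mxE; apply: (b_indep (u 0)).
  rewrite -[RHS]uB mulmx_sum_row; apply: eq_bigr => k _.
  by rewrite rowK.
have BTrank : \rank B = d.
  rewrite -mxrank_tr; apply/eqP; rewrite -/(row_free B^T) -kermx_eq0.
  apply/eqP/row_matrixP => i; rewrite row0; set u := row i _.
  have uB : u *m B^T = 0 by apply/sub_kermxP; exact: row_sub.
  apply: b_total => j.
  have := congr1 (fun M : 'rV_m => M 0 j) uB; rewrite !mxE => <-.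
  by apply: eq_bigr => k _; rewrite !mxE.
have md : m = d by rewrite -Brank.
subst m.
have Bu : B^T \in unitmx by rewrite unitmx_tr -row_free_unit /row_free Brank.
pose V := invmx B^T.
have Vb i j : inner (row i V) (b j) = (i == j)%:R.
  have <- : (V *m B^T) i j = (i == j)%:R by rewrite mulVmx// mxE.
  by rewrite mxE; apply: eq_bigr => k _; rewrite !mxE.
have sumV (c : 'I_d -> R) j : inner (\sum_i c i *: row i V) (b j) = c j.
  rewrite inner_suml (bigD1 j)//= innerZl Vb eqxx mulr1 big1 ?addr0// => i ij.
  by rewrite innerZl Vb (negPf ij) mulr0.
exists [tuple row i V | i < d].
  apply/freeP => k k0 i.
  rewrite -(sumV k i) -[RHS](inner0l (b i)) -[in RHS]k0; congr inner.
  by apply: eq_bigr => j _; rewrite (nth_map j) ?size_enum_ord ?nth_ord_enum.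
apply/seteqP; split=> x /= hx.
  exists (fun i => inner x (b i)) => //.
  apply/eqP; rewrite -subr_eq0; apply/eqP/b_total => j.
  rewrite innerDl -scaleN1r innerZl.
  under eq_bigr do rewrite tnth_mktuple.
  by rewrite sumV mulN1r subrr.
case: hx => c c0 -> i.
by under eq_bigr do rewrite tnth_mktuple; rewrite sumV.
Qed.

(** * Irredundant generators of a finitely generated cone *)

Section Cones.
Variables (R : realType) (V : lmodType R) (I : finType) (b : I -> V).
Implicit Types (A : {set I}) (c : I -> R).

Definition in_cone A (x : V) : Prop :=
  exists2 c : I -> R, (forall i, 0 <= c i) & x = \sum_(i in A) c i *: b i.

(** Take [A] minimal for inclusion among the generating sets: a generator that
    is a combination of the others can be substituted away. *)
Lemma irredundant_generators :
  exists2 A : {set I}, forall k, in_cone A (b k)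
    & forall j, j \in A -> ~ in_cone (A :\ j) (b j).
Proof.
pose gen A := `[< forall k, in_cone A (b k) >].
have genT : exists A, gen A.
  exists (finset.setTfor I); apply/asboolP => k; exists (fun i => (i == k)%:R).
    by move=> i; rewrite ler0n.
  rewrite (bigD1 k) ?finset.in_setT//= eqxx scale1r.
  by rewrite big1 ?addr0// => i /andP[_ /negPf ->]; rewrite scale0r.
have [A /minsetP[/asboolP Agen Amin]] := ex_minset genT.
exists A => // j jA [c c0 bj].
suff /Amin/(_ (subD1set _ _)) /finset.setP/(_ j) : gen (A :\ j).
  by rewrite !inE eqxx jA.
apply/asboolP => k; have [e e0 bk] := Agen k.
exists (fun i => e j * c i + e i) => [i|]; first by rewrite addr_ge0 ?mulr_ge0.
rewrite bk (big_setD1 j)//= {1}bj scaler_sumr -big_split/=.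
by apply: eq_bigr => i _; rewrite scalerA scalerDl.
Qed.

End Cones.

(** An irredundant generator [b j] of a pointed cone spans an extremal ray: if
    [s] were negative, moving [s *: b i] to the other side of
    [s *: b i + t *: b j = \sum_k c k *: b k] would express [b j] through the
    other generators.  The form [(x0, _)], positive on the generators, shows
    that the coefficient by which one divides is positive. *)
Lemma cone_irredundant_coef_ge0 (R : realType) (d : nat) (I : finType)
    (b : I -> 'rV[R]_d) (x0 : 'rV[R]_d) (A : {set I}) (i j : I) (s t : R) :
  (forall k, 0 < inner x0 (b k)) ->
  i \in A -> j \in A -> i != j -> ~ in_cone b (A :\ j) (b j) ->
  in_cone b A (s *: b i + t *: b j) -> 0 <= s.
Proof.
move=> b_pos iA jA ij jirr [c c0]; rewrite (big_setD1 j)//= => E.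
rewrite leNgt; apply/negP => s0; apply: jirr.
pose c' k := c k - (k == i)%:R * s.
have c'0 k : 0 <= c' k.
  by rewrite subr_ge0 (le_trans _ (c0 k))//; case: eqP; rewrite ?mul1r ?mul0r// ltW.
have iAj : i \in A :\ j by rewrite !inE ij.
have E' : (t - c j) *: b j = \sum_(k in A :\ j) c' k *: b k.
  rewrite /c'; under eq_bigr do rewrite scalerBl.
  rewrite sumrB [X in _ = _ - X](bigD1 i)//= eqxx mul1r.
  rewrite [X in _ - (_ + X)]big1 ?addr0; last first.
    by move=> k /andP[_ /negPf ->]; rewrite mul0r scale0r.
  apply/eqP; rewrite eq_sym subr_eq -(inj_eq (addrI (c j *: b j))) -E.
  by rewrite addrA -scalerDl [c j + _]addrC subrK addrC.
have tc : 0 < t - c j.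
  rewrite -(pmulr_lgt0 _ (b_pos j)) -innerZr E' inner_sumr.
  rewrite (bigD1 i)//= ltr_pwDl//.
    rewrite innerZr mulr_gt0// /c' eqxx mul1r subr_gt0.
    exact: lt_le_trans s0 (c0 i).
  by apply: sumr_ge0 => k _; rewrite innerZr mulr_ge0// ltW.
exists (fun k => (t - c j)^-1 * c' k).
  by move=> k; rewrite mulr_ge0// invr_ge0 ltW.
under eq_bigr do rewrite -scalerA.
by rewrite -scaler_sumr -E' scalerA mulVf ?scale1r// gt_eqF.
Qed.

(** * Walls of a chamber of a vee-system *)

Section VeeSystem.
Variables (R : realType) (d n : nat) (alpha : 'I_n -> 'rV[R]_d).
Hypothesis halpha : euclidean_vee_system alpha.

Lemma vee_total x : (forall i, inner x (alpha i) = 0) -> x = 0.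
Proof.
move=> x0; apply: inner_eq0; rewrite -(vee_V1 halpha).
by apply: big1 => i _; rewrite x0 expr0n.
Qed.

(** The conclusion of (V2) in polarized form. *)
Lemma isotropic_sum_orthogonal (P : {vspace 'rV[R]_d}) (nu : R) :
  (forall x, x \in P ->
    \sum_(k | alpha k \in P) inner x (alpha k) ^+ 2 = nu * inner x x) ->
  forall x y, x \in P -> y \in P -> inner x y = 0 ->
  \sum_(k | alpha k \in P) inner x (alpha k) * inner y (alpha k) = 0.
Proof.
move=> Pnu x y xP yP xy.
have := Pnu _ (memvD xP yP).
have -> : \sum_(k | alpha k \in P) inner (x + y) (alpha k) ^+ 2 =
    \sum_(k | alpha k \in P) inner x (alpha k) ^+ 2 +
    \sum_(k | alpha k \in P) inner y (alpha k) ^+ 2 +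
    (\sum_(k | alpha k \in P) inner x (alpha k) * inner y (alpha k)) *+ 2.
  rewrite -sumrMnl -!big_split/=; apply: eq_bigr => k _.
  by rewrite innerDl sqrrD addrAC.
rewrite (Pnu _ xP) (Pnu _ yP) innerDl !innerDr (innerC y x) xy add0r addr0.
rewrite mulrDr -[RHS]addr0 => /addrI/eqP; rewrite mulrn_eq0/=.
by move/eqP.
Qed.

Variables (eps : 'I_n -> R) (x0 : 'rV[R]_d).
Hypothesis eps_sqr : forall k, eps k * eps k = 1.
Let beta k := eps k *: alpha k.
Hypothesis beta_pos : forall k, 0 < inner x0 (beta k).

(** An acute angle between two walls would contain all the covectors of their
    plane, and a system of vectors in an acute angle is never isotropic. *)
Lemma vee_walls_obtuse (A : {set 'I_n}) :
  (forall k, in_cone beta A (beta k)) ->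
  (forall j, j \in A -> ~ in_cone beta (A :\ j) (beta j)) ->
  forall i j, i \in A -> j \in A -> i != j -> inner (beta i) (beta j) <= 0.
Proof.
move=> Agen Airr i j iA jA ij.
have alphaE k : alpha k = eps k *: beta k.
  by rewrite scalerA eps_sqr scale1r.
pose P := <<[:: alpha i; alpha j]>>%VS.
have iP : alpha i \in P by apply: memv_span; rewrite !inE eqxx.
have jP : alpha j \in P by apply: memv_span; rewrite !inE eqxx orbT.
have dimP : \dim P = 2%N.
  suff : free [:: alpha i; alpha j] by move/eqP.
  rewrite free_cons span_seq1 seq1_free (vee_neq0 halpha) andbT.
  by apply/negP => /vlineP[c]; exact: (vee_nonproportional halpha).
have [P3|P2] := leqP 3 #|[pred k | alpha k \in P]|; last first.
  suff Pij : [pred k | alpha k \in P] =i pred2 i j.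
    by rewrite innerZl innerZr (vee_V3 halpha dimP ij Pij) !mulr0.
  have sub : pred2 i j \subset [pred k | alpha k \in P].
    by apply/fintype.subsetP => k /pred2P[] ->; rewrite inE.
  have := subset_leqif_card sub; rewrite card2 ij => -[_].
  rewrite eqn_leq (leq_trans _ (subset_leq_card sub)) ?card2 ?ij// -ltnS P2.
  move=> /esym/fintype.subsetP sup k; apply/idP/idP; first exact: sup.
  exact: (fintype.subsetP sub).
rewrite leNgt; apply/negP => bij.
have [nu Pnu] := vee_V2 halpha dimP P3.
have beta_neq0 k : beta k != 0.
  by apply: contraTneq (beta_pos k) => ->; rewrite innerC inner0l ltxx.
have bii := inner_gt0 (beta_neq0 i).
have betaP k : alpha k \in P -> beta k \in P by exact: memvZ.
(* The component of [beta j] orthogonal to [beta i], up to a positive factor. *)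
pose y := inner (beta i) (beta i) *: beta j - inner (beta i) (beta j) *: beta i.
have yP : y \in P by rewrite memvB// memvZ// betaP.
have iy : inner (beta i) y = 0.
  by rewrite /y innerDr -scaleNr !innerZr; ring.
have y0 : y != 0.
  apply/negP => /eqP/eqP; rewrite subr_eq0 => /eqP E.
  pose r := (inner (beta i) (beta i))^-1 * inner (beta i) (beta j).
  have bj : beta j = r *: beta i.
    by rewrite -scalerA -E scalerA mulVf ?scale1r// gt_eqF.
  have ji : j != i by rewrite eq_sym.
  apply: (vee_nonproportional halpha ji (c := eps j * r * eps i)).
  by rewrite [LHS]alphaE bj -[RHS]scalerA -[RHS]scalerA.
(* [(beta i, beta i) * (y, beta j) = (y, y)], as [y] is orthogonal to [beta i]. *)
have yj : 0 < inner y (beta j).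
  rewrite -(pmulr_rgt0 _ bii) -innerZr.
  have -> : inner (beta i) (beta i) *: beta j =
      y + inner (beta i) (beta j) *: beta i by rewrite subrK.
  by rewrite innerDr innerZr (innerC y (beta i)) iy mulr0 addr0 inner_gt0.
have yi : inner y (beta i) = 0 by rewrite innerC.
have s0 := isotropic_sum_orthogonal Pnu (betaP i iP) yP iy.
have prodE u v k :
    inner u (alpha k) * inner v (alpha k) = inner u (beta k) * inner v (beta k).
  by rewrite !innerZr mulrACA eps_sqr mul1r.
suff ge0 k : alpha k \in P ->
    0 <= inner (beta i) (alpha k) * inner y (alpha k).
  have := psumr_eq0P ge0 s0 jP; rewrite prodE.
  by apply/eqP; rewrite gt_eqF// mulr_gt0.
move=> kP; rewrite prodE.
have [s [t bk]] : exists s t, beta k = s *: beta i + t *: beta j.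
  move: (betaP k kP); rewrite /P span_cons span_seq1.
  move=> /memv_addP[_ /vlineP[s ->] [_ /vlineP[t ->] ->]].
  exists (s * eps i), (t * eps j).
  by rewrite (alphaE i) (alphaE j) !scalerA.
have s_ge0 : 0 <= s.
  by apply: (cone_irredundant_coef_ge0 beta_pos iA jA ij (Airr _ jA) (t := t));
    rewrite -bk.
have t_ge0 : 0 <= t.
  apply: (cone_irredundant_coef_ge0 beta_pos jA iA _ (Airr _ iA) (t := s)).
    by rewrite eq_sym.
  by rewrite addrC -bk.
rewrite bk !innerDr !(innerZr s) !(innerZr t) yi mulr0 add0r.
by apply: mulr_ge0; rewrite ?addr_ge0 ?mulr_ge0// ltW.
Qed.

End VeeSystem.

(** * Chambers as open cones *)

Section Chambers.
Variables (R : realType) (d n : nat) (alpha : 'I_n -> 'rV[R]_d).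
Variable x0 : 'rV[R]_d.

Lemma arrangement_complementE :
  arrangement_complement (arrangement_of alpha) =
  [set x | forall i, inner x (alpha i) != 0].
Proof.
apply/seteqP; split=> x /=.
  move=> xH i; apply/negP => /eqP xi; apply: xH.
  by exists (orthogonal_hyperplane (alpha i)); first by exists i.
by move=> xi [_ [i _ <-]] /eqP; apply/negP.
Qed.

Hypothesis x0_generic : forall i, inner x0 (alpha i) != 0.

Let beta i := Num.sg (inner x0 (alpha i)) *: alpha i.

Lemma base_pos i : 0 < inner x0 (beta i).
Proof. by rewrite innerZr -normrEsg normr_gt0. Qed.

(** The cone is a union of segments issued from [x0]. *)
Lemma open_cone_connected : connected [set x | forall i, 0 < inner x (beta i)].
Proof.
set C := [set x | _].
pose seg (y : 'rV[R]_d) (t : R) := x0 + t *: (y - x0).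
have segC y : C y -> seg y @` `[0, 1] `<=` C.
  move=> Cy _ [t /= t01 <-] i; move: t01; rewrite in_itv/= => /andP[t0 t1].
  rewrite /seg innerDl innerZl innerDl -scaleN1r innerZl.
  have := base_pos i; have := Cy i; nra.
have -> : C = \bigcup_(y in C) (seg y @` `[0, 1]).
  apply/seteqP; split=> [y Cy|y [z Cz]]; last exact: segC.
  exists y => //; exists 1; first by rewrite /= in_itv/= ler01 lexx.
  by rewrite /seg scale1r addrC subrK.
apply: bigcup_connected.
  exists x0 => y _; exists 0; first by rewrite /= in_itv/= ler01 lexx.
  by rewrite /seg scale0r addr0.
move=> y _; apply: connected_continuous_connected; first exact: segment_connected.
apply: continuous_subspaceT => t; apply: cvgD; first exact: cvg_cst.
by apply: cvgZr_tmp; exact: cvg_id.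
Qed.

(** No [inner _ (beta i)] vanishes on the complement of the arrangement, so by
    the intermediate value property it keeps its sign on the component of
    [x0]. *)
Lemma chamberE :
  connected_component (arrangement_complement (arrangement_of alpha)) x0 =
  [set x | forall i, 0 < inner x (beta i)].
Proof.
rewrite arrangement_complementE; apply/seteqP; split.
  move=> x xC i; rewrite ltNge; apply/negP => xi.
  set E := connected_component _ _ in xC.
  pose f y := inner y (beta i).
  have /connected_intervalP itvE : connected (f @` E).
    apply: connected_continuous_connected; first exact: component_connected.
    by apply: continuous_subspaceT; exact: inner_continuous.
  have Ex0 : E x0 by apply: connected_component_refl.
  have [y Ey fy0] : (f @` E) 0.
    apply: (itvE (f x) (f x0)); [by exists x | by exists x0 |].
    by rewrite xi ltW// base_pos.
  have /(_ i) := connected_component_sub Ey.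
  by move: fy0; rewrite /f innerZr => /eqP; rewrite mulf_eq0 sgr_eq0
    (negPf (x0_generic i))/= => ->.
apply: connected_component_max.
- exact: base_pos.
- move=> x xC i; have := xC i; rewrite innerZr.
  by apply: contraTneq => ->; rewrite mulr0 ltxx.
- exact: open_cone_connected.
Qed.

(** A point [x] of the closed cone is the limit of [x + t *: x0], which lies in
    the open cone for [t > 0]. *)
Lemma closure_open_cone :
  closure [set x | forall i, 0 < inner x (beta i)] =
  [set x | forall i, 0 <= inner x (beta i)].
Proof.
apply/seteqP; split.
  rewrite closureE; apply: smallest_sub => [|x xC i]; last exact: ltW.
  have -> : [set x | forall i, 0 <= inner x (beta i)] =
      \bigcap_i ((fun x => inner x (beta i)) @^-1` [set t | 0 <= t]).
    by apply/seteqP; split=> x /= xC i => [_|]; exact: xC.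
  apply: closed_bigI => i _; apply: closed_comp; last exact: closed_ge.
  by move=> x _; exact: inner_continuous.
move=> x xC.
pose g (t : R) : 'rV[R]_d := x + t *: x0.
have gx : g t @[t --> 0^'+] --> x.
  rewrite -[X in _ --> X](_ : g 0 = x); last by rewrite /g scale0r addr0.
  apply: cvg_at_right_filter.
  apply: cvgD; first exact: cvg_cst.
  by apply: cvgZr_tmp; exact: cvg_id.
apply: (@closed_cvg _ _ _ _ g (closure _) (@closed_closure _ _) _ x gx).
near=> t; apply: subset_closure => i /=.
have t0 : 0 < t by near: t; exact: nbhs_right_gt.
by rewrite /g innerDl innerZl ltr_wpDl ?mulr_gt0 ?base_pos.
Unshelve. all: by end_near. Qed.

End Chambers.

Theorem theorem1p6 (R : realType) (d n : nat) (alpha : 'I_n -> 'rV[R]_d)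
  (halpha : euclidean_vee_system alpha) :
  simplicial_arrangement (arrangement_of alpha).
Proof.
move=> _ [x0 x0H ->].
have x0_generic i : inner x0 (alpha i) != 0.
  by move: x0H; rewrite arrangement_complementE.
rewrite chamberE// closure_open_cone//.
set eps := fun i => Num.sg (inner x0 (alpha i)).
pose beta i := eps i *: alpha i.
have eps_sqr i : eps i * eps i = 1 by rewrite -expr2 sqr_sg x0_generic.
have beta_pos i : 0 < inner x0 (beta i) by exact: base_pos.
have [A Agen Airr] := irredundant_generators beta.
pose b (k : 'I_#|A|) := beta (enum_val k).
have b_ge0 x : (forall k, 0 <= inner x (b k)) -> forall i, 0 <= inner x (beta i).
  move=> xb i; have [c c0 ->] := Agen i.
  rewrite inner_sumr; apply: sumr_ge0 => j jA; rewrite innerZr mulr_ge0//.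
  by rewrite -(enum_rankK_in jA jA); exact: xb.
have -> : [set x | forall i, 0 <= inner x (beta i)] =
    [set x | forall k, 0 <= inner x (b k)].
  by apply/seteqP; split=> x /= xC; [move=> k; exact: xC | exact: b_ge0].
apply: simplicial_cone_of_basis.
  apply: (obtuse_free (x0 := x0)) => [k|i j ij]; first exact: beta_pos.
  apply: (vee_walls_obtuse halpha eps_sqr beta_pos Agen Airr);
    rewrite ?enum_valP//.
  by rewrite (inj_eq enum_val_inj).
move=> x xb; apply: (vee_total halpha) => i.
have -> : alpha i = eps i *: beta i by rewrite scalerA eps_sqr scale1r.
have [c c0 ->] := Agen i.
rewrite innerZr inner_sumr big1 ?mulr0// => j jA; rewrite innerZr.
by rewrite -(enum_rankK_in jA jA) [inner _ _]xb mulr0.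
Qed.
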